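(* Let $X$ be a Hausdorff topological space, let $\lambda$ be a family of subsets of $X$ which covers $X$ and satisfies: (1) if $A\in\lambda$ and $A'\subseteq A$ then $A'\in\lambda$; (2) if $A_1,A_2\in\lambda$ then $A_1\cup A_2\in\lambda$; (3) if $A\in\lambda$ then $\overline{A}\in\lambda$. Let $Y$ be a complete Hausdorff uniform space with uniformity $\mu$. Let $\mathcal{P}$ be a boundedness type property such that every subset of $C_p(X,Y)$ that has property $\mathcal{P}$ (in $C_p(X,Y)$) is relatively compact in $C_p(X,Y)$. Then every subset of $C_{\lambda,\mu}(X,Y)$ that has property $\mathcal{P}$ (in $C_{\lambda,\mu}(X,Y)$) is relatively compact in $C_{\lambda,\mu}(X,Y)$.
   Context: $C_{\lambda,\mu}(X,Y)$ is the set $C(X,Y)$ of continuous maps with the topology of uniform convergence on elements of $\lambda$, i.e. the topology induced by the uniformity generated by the sets $\langle A,M\rangle=\{(f,g)\in C(X,Y)^2: (f(x),g(x))\in M \text{ for all } x\in A\}$, $A\in\lambda$, $M\in\mu$. $C_p(X,Y)$ is $C(X,Y)$ with the topology of pointwise convergence. A subset is relatively compact in a space if its closure in that space is compact; a subset $A$ of a space $Z$ is bounded in $Z$ if every continuous real-valued function on $Z$ is bounded on $A$. A property $\mathcal{P}$ of subsets of topological spaces (so ''$A$ has $\mathcal{P}$ in $Z$'' makes sense for $A\subseteq Z$) is continuously invariant if, whenever $A\subseteq Z$ has $\mathcal{P}$ in $Z$ and $f:Z\to W$ is continuous, $f(A)$ has $\mathcal{P}$ in $f(Z)$. A continuously invariant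 property $\mathcal{P}$ is of boundedness type if every subset $A$ of a space $Z$ having property $\mathcal{P}$ in $Z$ is bounded in $Z$. *)

(* Defs.v *)
From HB Require Import structures.
From mathcomp Require Import all_boot all_order all_algebra.
From mathcomp Require Import all_classical all_reals all_analysis.
Import Order.TTheory GRing.Theory Num.Theory.
Import numFieldNormedType.Exports.
Set Implicit Arguments.
Unset Strict Implicit.
Unset Printing Implicit Defensive.
Local Open Scope classical_set_scope.
Local Open Scope ring_scope.

(* Not [completeType], which would force the space to be inhabited. *)
Definition complete_uniform (Y : uniformType) :=
  forall F : set_system Y, ProperFilter F -> cauchy F -> exists y : Y, F --> y.

Definition relatively_compact (Z : topologicalType) (A : set Z) :=
  compact (closure A).

Definition bounded_in (R : realType) (Z : topologicalType) (A : set Z) :=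
  forall g : Z -> R, continuous g -> [bounded g z | z in A].

Section function_spaces.
Variables (X : topologicalType) (Y : uniformType).

Definition Cp : Type :=
  @initial_topology (continuousType X Y) {ptws X -> Y} (fun f => f).

HB.instance Definition _ := Uniform.copy Cp
  (@initial_topology (continuousType X Y) {ptws X -> Y} (fun f => f)).

(* The uniformity of [{family lambda, X -> Y}] is generated by the sets
   {(f, g) | forall x, A x -> M (f x, g x)} with A in lambda and M an entourage
   of Y; [initial_topology] restricts it to the continuous functions. *)
Definition Clambda (lambda : set (set X)) : Type :=
  @initial_topology (continuousType X Y) {family lambda, X -> Y} (fun f => f).

HB.instance Definition _ (lambda : set (set X)) := Uniform.copy (Clambda lambda)
  (@initial_topology (continuousType X Y) {family lambda, X -> Y} (fun f => f)).

End function_spaces.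
Arguments Clambda : clear implicits.

(* [P Z A] reads: the subset A has the property P in the space Z. *)
Definition subset_property := forall Z : topologicalType, set Z -> Prop.

(* In the first clause, the space f(Z) is the subtype of W carried by [range f],
   with the subspace topology, and f(A) is regarded as a subset of that subtype.
   When f is onto, the space f(Z) is W itself, but the types [set_type setT] and
   W are distinct; the second clause identifies the two. *)
Definition continuously_invariant (P : subset_property) :=
  (forall (Z W : topologicalType) (f : Z -> W) (A : set Z),
     continuous f -> P Z A ->
     P (set_type (range f)) (set_val @^-1` (f @` A))) /\
  (forall (W : topologicalType) (B : set W),
     P (set_type [set: W]) (set_val @^-1` B) -> P W B).

Definition boundedness_type (R : realType) (P : subset_property) :=
  continuously_invariant P /\
  forall (Z : topologicalType) (A : set Z), P Z A -> bounded_in R A.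

(* Main.v *)
(* A set [B] with property [P] in [C_lambda] is functionally bounded there, and
   in any uniform space a functionally bounded set is totally bounded: an
   infinite uniformly separated sequence would carry a continuous function
   unbounded along it.  So every ultrafilter [F] containing the closure of [B]
   is Cauchy.  Since [lambda] covers [X], the identity [C_lambda -> C_p] is
   continuous, hence [B] has [P] in [C_p] and [F] converges pointwise to some
   continuous [f].  A Cauchy filter for uniform convergence on the members of
   [lambda] converges in that sense to its pointwise limit, so [F] tends to [f]
   in [C_lambda]. *)
Require Import Defs.
From mathcomp Require Import all_boot all_order all_algebra finmap.
From mathcomp Require Import all_classical all_reals all_analysis.
Import Order.TTheory GRing.Theory Num.Theory.
Import numFieldNormedType.Exports.
Set Implicit Arguments.
Unset Strict Implicit.
Unset Printing Implicit Defensive.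
Local Open Scope classical_set_scope.

Section uniform_spaces.
Local Open Scope ring_scope.
Context {Z : uniformType}.

(** Four steps is the length of the longest chain used below: two points, each joined to a common
    third one through an intermediate point. *)
Lemma entourage_sym_split4 (E : set (Z * Z)) : entourage E ->
  exists V : set (Z * Z), [/\ entourage V,
    forall x y, V (x, y) -> V (y, x) &
    forall x y z t u,
      V (x, y) -> V (y, z) -> V (z, t) -> V (t, u) -> E (x, u)].
Proof.
move=> entE; pose V := split_ent (split_ent E).
exists (V `&` V^-1%relation); split.
- by apply: entourage_invI; do 2!apply: entourage_split_ent.
- by move=> x y [].
move=> x y z t u [xy _] [yz _] [zt _] [tu _].
apply: (entourage_split z) => //.
- by apply: (entourage_split y) => //; exact: entourage_split_ent.
- by apply: (entourage_split t) => //; exact: entourage_split_ent.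
Qed.

(* The bumps around the [b n] form a discrete family, so that their sum,
   weighted by [n], is locally a multiple of a single bump. *)
Lemma separated_seq_unbounded (R : realType) (E : set (Z * Z)) (b : nat -> Z) :
    entourage E -> (forall i j, (i < j)%N -> ~ E (b i, b j)) ->
  exists g : Z -> R, continuous g /\ forall n, g (b n) = n%:R.
Proof.
move=> entE sepb; have [V [entV Vsym V4]] := entourage_sym_split4 entE.
have Vrefl x : V (x, x) by exact: entourage_refl.
(* The chain [b n], [w], [z], [w'], [b m] would contradict separation if [n] and [m] differed. So
   the [V]-ball of any [z] meets at most one [V]-ball of the sequence. *)
have uniq_idx z w w' n m :
    V (b n, w) -> V (z, w) -> V (b m, w') -> V (z, w') -> n = m.
  move=> nw zw mw' zw'; have [nm|mn|//] := ltngtP n m.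
  - by case: (sepb _ _ nm); apply: (V4 _ w z w'); do ?[by []|exact: Vsym].
  - by case: (sepb _ _ mn); apply: (V4 _ w' z w); do ?[by []|exact: Vsym].
have bump n : exists f : Z -> R, [/\ continuous f, f (b n) = 0 &
    forall z, ~ V (b n, z) -> f z = 1].
  have /uniform_separatorW/(@uniform_separatorP _ R) [f [cf _ f0 f1]] :
      exists2 E', entourage E' &
        [set b n] `*` [set z | ~ V (b n, z)] `&` E' = set0.
    exists V => //; rewrite -subset0 => -[x z] /= [[-> nV]]; exact: nV.
  exists f; split => //; first by apply: f0; exists (b n).
  by move=> z nV; apply: f1; exists z.
have [f fP] := choice bump.
(* The index picked is forced by [uniq_idx], so [g] is the sum of the bumps [n%:R * (1 - f n z)],
   each vanishing off the [V]-ball of [b n]. *)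
pose g (z : Z) : R := if pselect (exists n, V (b n, z)) is left e
  then (projT1 (cid e))%:R * (1 - f (projT1 (cid e)) z) else 0.
have gE n z w w' : V (b n, w) -> V (z, w) -> V (z, w') ->
    g w' = n%:R * (1 - f n w').
  move=> nw zw zw'; rewrite /g; case: pselect => [e|ne].
    by case: (cid e) => m /= mw'; rewrite -(uniq_idx _ _ _ _ _ nw zw mw' zw').
  have [_ _ ->] := fP n; first by rewrite subrr mulr0.
  by move=> nw'; apply: ne; exists n.
have nearV z : \forall w \near z, V (z, w).
  by apply: filterS (nbhs_entourage z entV) => w /xsectionP.
exists g; split; last first.
  move=> n; rewrite (gE n (b n) (b n) (b n)) //.
  by have [_ -> _] := fP n; rewrite subr0 mulr1.
move=> z; have [[n [w [nw zw]]]|nex] :=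
    pselect (exists n, exists w, V (b n, w) /\ V (z, w)).
  rewrite /continuous_at (gE n z w z) //.
  have ctsh : (fun x => n%:R * (1 - f n x)) @ z --> n%:R * (1 - f n z).
    apply: cvgMr; apply: cvgB; first exact: cvg_cst.
    by have [cf _ _] := fP n; exact: cf.
  apply: cvg_trans ctsh; apply: near_eq_cvg.
  by apply: filterS (nearV z) => w' zw'; rewrite (gE n z w).
have g0 w : V (z, w) -> g w = 0.
  move=> zw; rewrite /g; case: pselect => // -[n nw].
  by case: nex; exists n, w.
rewrite /continuous_at g0 //.
have cst0 : (fun=> 0 : R) @ z --> (0 : R) by exact: cvg_cst.
apply: cvg_trans cst0; apply: near_eq_cvg.
by apply: filterS (nearV z) => w zw; rewrite g0.
Qed.

(** Without a finite [E]-net, points of [B] can be chosen greedily, each outside the [E]-balls of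
    its predecessors; a continuous function growing along them is unbounded on [B]. *)
Lemma bounded_in_totally_bounded (R : realType) (B : set Z) (E : set (Z * Z)) :
    bounded_in R B -> entourage E ->
  exists s : seq Z, forall z, B z -> exists2 c, c \in s & E (c, z).
Proof.
move=> bndB entE; apply: contrapT => notTB.
have /choice [next nextP] : forall s : seq Z, exists z,
    B z /\ forall c, c \in s -> ~ E (c, z).
  move=> s; apply: contrapT => nz; apply: notTB; exists s => z Bz.
  apply: contrapT => nc; apply: nz; exists z; split=> // c cs Ecz.
  by apply: nc; exists c.
(* [L n] lists the first [n] chosen points, so [b n] avoids the balls of all earlier ones. *)
pose L n := iter n (fun s => next s :: s) [::].
pose b n := next (L n).
have bL i j : (i < j)%N -> b i \in L j.
  elim: j => // j IHj; rewrite ltnS leq_eqVlt => /orP[/eqP->|ij].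
    exact: mem_head.
  by rewrite inE IHj ?orbT.
have sepb i j : (i < j)%N -> ~ E (b i, b j).
  by move=> ij; have [_] := nextP (L j); apply; exact: bL.
have [g [cg gb]] := separated_seq_unbounded R entE sepb.
have [M0 [_ gM]] := bndB g cg.
(* The bound must lie strictly above [M0] for [gM] and be nonnegative for [archi_boundP]. *)
have M0_lt : M0 < `|M0| + 1 by rewrite (le_lt_trans (ler_norm _)) ?ltrDl.
have M_ge0 : 0 <= `|M0| + 1 by rewrite addr_ge0.
have [Bn _] := nextP (L (Num.bound (`|M0| + 1))).
have : `|g (b (Num.bound (`|M0| + 1)))| <= `|M0| + 1 by exact: gM Bn.
rewrite gb ger0_norm // leNgt.
by rewrite archi_boundP.
Qed.

(** Finitely many small sets cover the closure of [B], and an ultrafilter containing a finite union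
    contains one of its members. *)
Lemma totally_bounded_ultra_small (B : set Z) (F : set_system Z) :
    (forall E, entourage E ->
      exists s : seq Z, forall z, B z -> exists2 c, c \in s & E (c, z)) ->
    UltraFilter F -> F (closure B) ->
  forall E, entourage E ->
    exists2 G, F G & forall x y, G x -> G y -> E (x, y).
Proof.
move=> tbB FU FB E entE; have [V [entV Vsym V4]] := entourage_sym_split4 entE.
have [s sP] := tbB _ entV.
(* Two [V]-steps: a point of the closure is [V]-close to a point of [B], itself [V]-close to some
   [c]. *)
pose N c := [set z | exists2 y, V (c, y) & V (y, z)].
suff [c FNc] : exists c, F (N c).
  exists (N c) => // x y [x' cx' x'x] [y' cy' y'y].
  by apply: (V4 _ x' c y'); do ?[by []|exact: Vsym].
have FF := ultra_proper.
have {FB} : F [set z | exists2 c, c \in s & N c z].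
  apply: filterS FB => z clBz.
  have [y [By /xsectionP zy]] := clBz _ (nbhs_entourage z entV).
  by have [c cs cy] := sP _ By; exists c => //; exists y => //; exact: Vsym.
elim: s {sP} => [|c s IHs] Fs.
  by case: (filter_ex Fs) => z [].
have [FNc|FnNc] := in_ultra_setVsetC (N c) FU; first by exists c.
apply: IHs; apply: filterS (filterI Fs FnNc) => z [[d + Nd] nNc].
by rewrite inE => /orP[/eqP dc|ds]; [case: nNc; rewrite -dc|exists d].
Qed.
End uniform_spaces.

(** The supremum uniformity is generated by finite intersections of entourages of its members; the
    one-element family at [(i, E)] yields [E]. *)
Lemma entourage_sup (T : choiceType) (I : Type) (Tc : I -> Uniform T) (i : I)
    (E : set (T * T)) :
  @entourage (Uniform.Pack (Tc i)) E -> @entourage (sup_topology Tc) E.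
Proof.
move=> entE; exists E => //.
pose ent (p : {classic I} * set (T * T)) :=
  `[< @entourage (Uniform.Pack (Tc p.1)) p.2 >].
have iE : ent (i, E) by exact/asboolP.
exists [fset (exist ent (i, E) iE : {p | ent p})]%fset.
  by move=> p _; rewrite inE.
apply/seteqP; split=> [xy /(_ (exist ent (i, E) iE))|xy Exy p /=].
  by apply; rewrite /= inE.
by rewrite inE => /eqP ->.
Qed.

Section continuous_maps.
Context {X : topologicalType} {Y : uniformType} {lambda : set (set X)}.

Lemma entourage_Clambda (A : set X) (M : set (Y * Y)) :
    lambda A -> entourage M ->
  entourage [set fg : Clambda X Y lambda * Clambda X Y lambda |
    forall x, A x -> M (fg.1 x, fg.2 x)].
Proof.
move=> lA entM.
exists [set fg : {family lambda, X -> Y} * {family lambda, X -> Y} |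
    forall x, A x -> M (fg.1 x, fg.2 x)] => //.
apply: (@entourage_sup _ _ _ (existT _ A lA)).
by rewrite uniform_entourage; exists M.
Qed.

Lemma cvg_Clambda (F : set_system (Clambda X Y lambda))
    (f : Clambda X Y lambda) :
    Filter F ->
    (forall A M, lambda A -> entourage M ->
      F [set g : Clambda X Y lambda | forall x, A x -> M (f x, g x)]) ->
  F --> f.
Proof.
move=> FF Fcvg U [/= _ [[W oW <-] Wf WU]].
pose G : set_system (X -> Y) := (fun g : Clambda X Y lambda => g : X -> Y) @ F.
have FG : Filter G by exact: fmap_filter.
have cvgf : {family lambda, G --> (f : X -> Y)}.
  apply/fam_cvgP => A lA V /uniform_nbhs [M [entM MV]].
  by apply: filterS (Fcvg A M lA entM) => g; exact: MV.
have /cvgf : nbhs (f : {family lambda, X -> Y}) W by exact: open_nbhs_nbhs.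
by move=> GW; apply: (@filterS _ F FF _ _ _ GW) => g; exact: WU.
Qed.

Lemma cvg_Cp_near (F : set_system (Cp X Y)) (f : Cp X Y) (x : X)
    (M : set (Y * Y)) : F --> f -> entourage M ->
  F [set g : Cp X Y | M (f x, g x)].
Proof.
move=> Ff entM.
have nf : nbhs (f : {ptws X -> Y}) [set g | M (f x, g x)].
  have := @proj_continuous X (fun=> Y) x f _ (nbhs_entourage (f x) entM).
  by apply: (@filterS {ptws X -> Y}) => g /xsectionP.
exact/Ff/(@initial_continuous _ {ptws X -> Y}
  (fun g : continuousType X Y => g) f _ nf).
Qed.

Lemma Clambda_Cp_continuous : \bigcup_(A in lambda) A = [set: X] ->
  continuous ((fun f => f) : Clambda X Y lambda -> Cp X Y).
Proof.
move=> cover.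
apply: (@continuous_comp_initial _ _ {ptws X -> Y}) => f.
pose G : set_system (X -> Y) := (fun g : Clambda X Y lambda => g : X -> Y) @ f.
have FG : Filter G by apply: fmap_filter; exact: nbhs_filter.
suff : {ptws, G --> (f : X -> Y)} by [].
apply/pointwise_cvgP => x; apply/cvg_entourageP => M entM.
have [A lA Ax] : (\bigcup_(A in lambda) A) x by rewrite cover.
have := nbhs_entourage f (entourage_Clambda lA entM).
by apply: (@filterS (Clambda X Y lambda)) => g /xsectionP; exact.
Qed.

End continuous_maps.

Lemma continuously_invariant_surj (P : subset_property) (Z W : topologicalType)
    (f : Z -> W) (A : set Z) :
    continuously_invariant P -> continuous f -> range f = setT -> P Z A ->
  P W (f @` A).
Proof.
move=> [Prange PsetT] cf fT /(Prange _ _ _ _ cf) PA; apply: PsetT.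
(* The rewriting takes place in the type [set_type (range f)], which becomes the one required by the
   second clause of invariance. *)
by rewrite fT in PA.
Qed.

Theorem theorem4p9 (R : realType) (X : topologicalType) (Y : uniformType)
  (lambda : set (set X)) (P : subset_property)
  (hausX : hausdorff_space X)
  (lambda_cover : \bigcup_(A in lambda) A = [set: X])
  (lambda_sub : forall A A' : set X, lambda A -> A' `<=` A -> lambda A')
  (lambda_setU : forall A1 A2 : set X,
     lambda A1 -> lambda A2 -> lambda (A1 `|` A2))
  (lambda_closure : forall A : set X, lambda A -> lambda (closure A))
  (hausY : hausdorff_space Y)
  (complY : complete_uniform Y)
  (bddP : boundedness_type R P)
  (P_Cp : forall B : set (Cp X Y),
     P (Cp X Y) B -> relatively_compact B) :
  forall B : set (Clambda X Y lambda),
    P (Clambda X Y lambda) B -> relatively_compact B.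
Proof.
move=> B PB; have [Pinv /(_ _ _ PB) bndB] := bddP.
pose i : Clambda X Y lambda -> Cp X Y := fun f => f.
have ci : continuous i by exact: Clambda_Cp_continuous.
have /P_Cp cptB : P (Cp X Y) (i @` B).
  apply: continuously_invariant_surj => //.
  by rewrite -subTset => f _; exists f.
rewrite /relatively_compact compact_ultra => F FU FB.
have FF := ultra_proper.
have small := totally_bounded_ultra_small
  (fun E => @bounded_in_totally_bounded _ R B E bndB) FU FB.
have Fcl : (i @ F) (closure (i @` B)).
  apply: (@filterS _ F _ _ _ _ FB) => f clBf U /(ci f) nU.
  have [g [Bg Ug]] := clBf _ nU.
  by exists (i g); split => //; exists g.
have [f [_ Ff]] : closure (i @` B) `&` [set f | i @ F --> f] !=set0.
  by move: cptB; rewrite /relatively_compact compact_ultra; apply.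
have cvgf : F --> (f : Clambda X Y lambda).
  apply: cvg_Clambda => A M lA entM.
  have [V [entV Vsym V4]] := entourage_sym_split4 entM.
  have [G FG Gsmall] := small _ (entourage_Clambda lA entV).
  apply: (filterS _ FG) => g Gg x Ax.
  (* The map [h] depends on [x] but [G] does not, so the resulting estimate is uniform on [A]. *)
  have [h [Gh fh]] := filter_ex (filterI FG (cvg_Cp_near x Ff entV)).
  have gh := Gsmall _ _ Gg Gh x Ax.
  by apply: (V4 _ (f x) (f x) (h x)); do ?[exact: entourage_refl|by []|exact: Vsym].
exists f; split => //.
by apply: closed_closure => U /cvgf FU'; exact: filter_ex (filterI FB FU').
Qed.
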